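(* The quantities $$\sum_{i\in I}\min\Big\{\gamma,\ \min_{j\in J}\{\beta d_{i,j}\}\Big\}\,\underline{W}_{i,t},\qquad t\in T,$$ are valid lower bounds on the recourse of the mobile facility routing and scheduling problem for each time period; that is, for every $(x,y)\in\mathcal{X}$, every $W\in\mathcal{S}$ and every $t\in T$, $$Q_t(x,W)\ \ge\ \sum_{i\in I}\min\Big\{\gamma,\ \min_{j\in J}\{\beta d_{i,j}\}\Big\}\,\underline{W}_{i,t}.$$
   Context: Let $I$ (customers), $J$ (candidate locations), $M$ (mobile facilities) be finite nonempty index sets and $T=\{1,\dots,|T|\}$ a finite set of time periods. Data: distances $d_{i,j}\ge 0$, travel times $t_{j,j'}\in\mathbb{Z}_{\ge 0}$, assignment cost factor $\beta\ge 0$, capacity $C\ge 0$, unmet-demand penalty $\gamma\ge 0$. The first-stage feasible region $\mathcal{X}$ is the set of all $(x,y)$ with $x_{j,m}^t\in\{0,1\}$, $y_m\in\{0,1\}$ for all $j\in J,m\in M,t\in T$, such that $x_{j,m}^t+x_{j',m}^{t'}\le y_m$ for all $t\in T$, $m\in M$, $j,j'\in J$ with $j\ne j'$, and $t'\in\{t,\dots,\min\{t+t_{j,j'},|T|\}\}$. The support of the demand is $\mathcal{S}=\{W\ge 0:\ \underline{W}_{i,t}\le W_{i,t}\le\overline{W}_{i,t}\ \forall i\in I,t\in T\}$, with given bounds $0\le\underline{W}_{i,t}\le\overline{W}_{i,t}<\infty$. For $(x,y)\in\mathcal{X}$ and $W\in\mathcal{S}$, the recourse (second-stage) problem decomposes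 by time period as $Q(x,W)=\sum_{t\in T}Q_t(x,W)$, where the period-$t$ recourse is $$Q_t(x,W)=\min_{z,u}\ \sum_{j\in J}\sum_{i\in I}\sum_{m\in M}\beta d_{i,j}z_{i,j,m}^t+\gamma\sum_{i\in I}u_{i,t}$$ subject to $\sum_{j\in J}\sum_{m\in M}z_{i,j,m}^t+u_{i,t}=W_{i,t}$ for all $i\in I$; $\sum_{i\in I}z_{i,j,m}^t\le C x_{j,m}^t$ for all $j\in J,m\in M$; $u_{i,t}\ge 0$, $z_{i,j,m}^t\ge 0$ for all $i\in I,j\in J,m\in M$. *)

(* Defs.v *)
From HB Require Import structures.
From mathcomp Require Import all_boot all_order all_algebra.
From mathcomp Require Import boolp classical_sets reals.
From mathcomp Require Import topology normedtype derive.

Set Implicit Arguments.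
Unset Strict Implicit.
Unset Printing Implicit Defensive.

Import Order.TTheory GRing.Theory Num.Theory.
Import numFieldNormedType.Exports.
Local Open Scope classical_set_scope.
Local Open Scope ring_scope.

(* The period t in {1, ..., nT} is encoded as t - 1 : 'I_nT, so the upper bound
   min(t + tau j j', nT) becomes minn (t + tau j j') nT.-1.  The binary
   variables are booleans, coerced to nat in the sum. *)
Definition first_stage_region (J M : finType) (nT : nat) (tau : J -> J -> nat)
    (x : J -> M -> 'I_nT -> bool) (y : M -> bool) : Prop :=
  forall (t : 'I_nT) (m : M) (j j' : J) (t' : 'I_nT), j != j' ->
    (t <= t' <= minn (t + tau j j') nT.-1)%N ->
    (x j m t + x j' m t' <= y m)%N.

Definition demand_support (R : realType) (I : finType) (nT : nat)
    (Wlo Wup : I -> 'I_nT -> R) : set (I -> 'I_nT -> R) :=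
  [set W | forall i t, 0 <= W i t /\ Wlo i t <= W i t <= Wup i t].

Section Recourse.
Variables (R : realType) (I J M : finType) (nT : nat).
Variables (d : I -> J -> R) (beta C gamma : R).
Variables (x : J -> M -> 'I_nT -> bool) (W : I -> 'I_nT -> R) (t : 'I_nT).

Definition recourse_cost (zu : (I -> J -> M -> R) * (I -> R)) : R :=
  \sum_(j : J) \sum_(i : I) \sum_(m : M) beta * d i j * zu.1 i j m
  + gamma * \sum_(i : I) zu.2 i.

Definition recourse_feasible : set ((I -> J -> M -> R) * (I -> R)) :=
  [set zu | [/\ forall i, \sum_(j : J) \sum_(m : M) zu.1 i j m + zu.2 i = W i t,
                forall j m, \sum_(i : I) zu.1 i j m <= C * (x j m t)%:R,
                forall i, 0 <= zu.2 i &
                forall i j m, 0 <= zu.1 i j m]].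

(* The infimum is a minimum, see [recourse_min]. *)
Definition recourse : R := inf (recourse_cost @` recourse_feasible).

End Recourse.

Definition min_over (R : realType) (J : finType) (J_gt0 : (0 < #|J|)%N)
    (F : J -> R) : R :=
  \big[Num.min/F (enum_val (Ordinal J_gt0))]_(j : J) F j.

Lemma min_over_le (R : realType) (J : finType) (J_gt0 : (0 < #|J|)%N)
    (F : J -> R) (j : J) : min_over J_gt0 F <= F j.
Proof. exact: bigmin_le_cond. Qed.

Lemma min_over_attained (R : realType) (J : finType) (J_gt0 : (0 < #|J|)%N)
    (F : J -> R) : exists j, min_over J_gt0 F = F j.
Proof.
rewrite /min_over; elim/big_ind: _ => [|a b [j ->] [k ->]|j _].
- by exists (enum_val (Ordinal J_gt0)).
- by case: (leP (F j) (F k)) => _; [exists j | exists k].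
- by exists j.
Qed.

Lemma recourse_min (R : realType) (I J M : finType) (nT : nat)
    (d : I -> J -> R) (beta C gamma : R)
    (x : J -> M -> 'I_nT -> bool) (W : I -> 'I_nT -> R) (t : 'I_nT) :
  0 <= C -> (forall i, 0 <= W i t) ->
  exists zu, [/\ recourse_feasible C x W t zu,
    recourse_cost d beta gamma zu = recourse d beta C gamma x W t &
    forall zu', recourse_feasible C x W t zu' ->
      recourse_cost d beta gamma zu <= recourse_cost d beta gamma zu'].
Proof.
move=> C0 W0; pose n := #|{: I * J * M}|.
pose z (v : 'rV[R]_n) i j m := v ord0 (enum_rank (i, j, m)).
pose u v i := W i t - \sum_(j : J) \sum_(m : M) z v i j m.
pose A := [set v | recourse_feasible C x W t (z v, u v)].
have cz i j m : continuous (fun v => z v i j m) by exact: coord_continuous.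
have csum (K : finType) (F : K -> 'rV[R]_n -> R) :
    (forall k, continuous (F k)) -> continuous (fun v => \sum_(k : K) F k v).
  by move=> cF; apply: (continuous_big (@add_continuous R)) => k _; exact: cF.
have cst (a : R) : continuous (fun _ : 'rV[R]_n => a) by exact: cst_continuous.
have cD (f g : 'rV[R]_n -> R) :
    continuous f -> continuous g -> continuous (fun v => f v + g v).
  by move=> cf cg v; exact: cvgD (cf v) (cg v).
have cM (f g : 'rV[R]_n -> R) :
    continuous f -> continuous g -> continuous (fun v => f v * g v).
  by move=> cf cg v; exact: cvgM (cf v) (cg v).
have cN (f : 'rV[R]_n -> R) : continuous f -> continuous (fun v => - f v).
  by move=> cf v; exact: cvgN (cf v).
have cu i : continuous (fun v => u v i).
  by apply: cD => //; apply: cN; do 2![apply: (csum _ _) => ?].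
have cload j m : continuous (fun v => \sum_(i : I) z v i j m).
  by apply: (csum _ _) => i; exact: cz.
have clP (f : 'rV[R]_n -> R) (B : set R) :
    continuous f -> closed B -> closed (f @^-1` B).
  by move=> /continuous_closedP; exact.
have clA : closed A.
  have -> : A = (\bigcap_(i in [set: I]) [set v | 0 <= u v i]) `&`
     ((\bigcap_(p in [set: J * M])
         [set v | \sum_(i : I) z v i p.1 p.2 <= C * (x p.1 p.2 t)%:R]) `&`
     (\bigcap_(p in [set: I * J * M]) [set v | 0 <= z v p.1.1 p.1.2 p.2])).
    apply/seteqP; split=> [v [_ /= h1 h2 h3]|v [h2 [h1 h3]]].
      by split=> [i _|]; [exact: h2 | split=> [p _|p _]; [exact: h1|exact: h3]].
    split=> /= [i|j m|i|i j m].
    - by rewrite /u addrC subrK.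
    - exact: (h1 (j, m)).
    - exact: h2.
    - exact: (h3 (i, j, m)).
  apply: closedI; last apply: closedI; apply: closed_bigI => p _.
  - exact: clP _ _ (cu p) (@closed_ge R 0).
  - exact: clP _ _ (cload p.1 p.2) (@closed_le R _).
  - exact: clP _ _ (cz p.1.1 p.1.2 p.2) (@closed_ge R 0).
have cpA : compact A.
  apply: (subclosed_compact clA
    (rV_compact (fun k : 'I_n => @segment_compact R 0 C))) => v [_ /= h1 h2 h3] k.
  have -> : v ord0 k = z v (enum_val k).1.1 (enum_val k).1.2 (enum_val k).2.
    by rewrite /z -!surjective_pairing enum_valK.
  move: (enum_val k) => [[i j] m] /=; rewrite in_itv /= h3 /=.
  apply: (le_trans (y := \sum_(i' : I) z v i' j m)).
    by rewrite (bigD1 i) //= lerDl; apply: sumr_ge0 => i' _; exact: h3.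
  by apply: (le_trans (h1 j m)); case: (x j m t); rewrite ?mulr1 ?mulr0.
have A0 : A !=set0.
  have z0 i j m : z 0 i j m = 0 by rewrite /z mxE.
  exists 0; split=> /= [i|j m|i|i j m].
  - by rewrite /u addrC subrK.
  - by rewrite big1 // mulr_ge0.
  - rewrite /u big1 ?subr0 // => j _; exact: big1.
  - by rewrite z0.
pose f v := recourse_cost d beta gamma (z v, u v).
have cf : continuous f.
  apply: cD; last by apply: (cM _ _ (cst _)); exact: csum.
  by do 3![apply: (csum _ _) => ?]; apply: (cM _ _ (cst _)); exact: cz.
have [c /set_mem Ac minc] := EVT_min_rV A0 cpA (continuous_subspaceT cf).
have minf zu : recourse_feasible C x W t zu -> f c <= recourse_cost d beta gamma zu.
  case: zu => z' u' zu'; pose v : 'rV[R]_n :=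
    \row_k z' (enum_val k).1.1 (enum_val k).1.2 (enum_val k).2.
  have zv : z v = z'.
    by apply/funext=> i; apply/funext=> j; apply/funext=> m;
       rewrite /z mxE enum_rankK.
  have uv : u v = u'.
    by apply/funext=> i; rewrite /u zv; case: zu' => /(_ i) /= <- _ _ _; rewrite addrC addKr.
  by have := minc v; rewrite /f zv uv; apply; apply/mem_set; rewrite /A /= zv uv.
exists (z c, u c); split=> //; apply/eqP; rewrite eq_le; apply/andP; split.
  by apply: lb_le_inf; [exists (f c), (z c, u c)|move=> _ [zu zuF <-]; exact: minf].
by apply: ge_inf; [exists (f c) => _ [zu zuF <-]; exact: minf|exists (z c, u c)].
Qed.

(* Main.v *)
Require Import Defs.
From mathcomp Require Import all_boot all_order all_algebra.
From mathcomp Require Import classical_sets reals.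

Import Order.TTheory GRing.Theory Num.Theory.
Local Open Scope classical_set_scope.
Local Open Scope ring_scope.

(** Every unit of demand of customer [i] is either served from some location [j],
    at unit cost [beta * d i j], or left unmet, at unit cost [gamma]; hence it
    costs at least [c i], the smaller of [gamma] and the least [beta * d i j].
    Summing over the flow conservation constraints, every feasible second-stage
    decision costs at least [\sum_i c i * W i t] ([recourse_cost_ge]), and this
    applies to the optimal one given by [recourse_min].  As [c i] is nonnegative,
    the demand can then be replaced by its lower bound. *)

(** Weak duality: any [c] below all the unit costs is feasible for the dual of the
    second-stage problem, with null multipliers on the capacity constraints. *)
Lemma recourse_cost_ge (R : realType) (I J M : finType) (nT : nat)
    (d : I -> J -> R) (beta C gamma : R)
    (x : J -> M -> 'I_nT -> bool) (W : I -> 'I_nT -> R) (t : 'I_nT)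
    (c : I -> R) (zu : (I -> J -> M -> R) * (I -> R)) :
  (forall i, c i <= gamma) -> (forall i j, c i <= beta * d i j) ->
  recourse_feasible C x W t zu ->
  \sum_(i : I) c i * W i t <= recourse_cost d beta gamma zu.
Proof.
move=> c_gamma c_d [demand _ u_ge0 z_ge0].
rewrite /recourse_cost exchange_big /= mulr_sumr -big_split /=.
apply: ler_sum => i _; rewrite -demand mulrDr; apply: lerD.
  rewrite mulr_sumr; apply: ler_sum => j _.
  rewrite mulr_sumr; apply: ler_sum => m _.
  exact: ler_wpM2r (z_ge0 i j m) _ _ (c_d i j).
exact: ler_wpM2r (u_ge0 i) _ _ (c_gamma i).
Qed.

Theorem proposition4 (R : realType) (I J M : finType) (nT : nat)
    (I_gt0 : (0 < #|I|)%N) (J_gt0 : (0 < #|J|)%N) (M_gt0 : (0 < #|M|)%N)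
    (d : I -> J -> R) (tau : J -> J -> nat) (beta C gamma : R)
    (Wlo Wup : I -> 'I_nT -> R)
    (d_ge0 : forall i j, 0 <= d i j)
    (beta_ge0 : 0 <= beta) (C_ge0 : 0 <= C) (gamma_ge0 : 0 <= gamma)
    (W_bounds : forall i t, 0 <= Wlo i t <= Wup i t)
    (x : J -> M -> 'I_nT -> bool) (y : M -> bool)
    (W : I -> 'I_nT -> R) (t : 'I_nT) :
  first_stage_region tau x y ->
  demand_support Wlo Wup W ->
  recourse d beta C gamma x W t >=
    \sum_(i : I) Num.min gamma (min_over J_gt0 (fun j => beta * d i j)) * Wlo i t.
Proof.
move=> _ W_supp.
have W_ge0 i : 0 <= W i t by case: (W_supp i t).
have [zu [zu_feas <- _]] := recourse_min d beta gamma x C_ge0 W_ge0.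
set c := fun i : I => Num.min gamma (min_over J_gt0 (fun j => beta * d i j)).
have c_ge0 i : 0 <= c i.
  rewrite /c le_min gamma_ge0 /=.
  by have [j ->] := min_over_attained J_gt0 (fun j => beta * d i j); rewrite mulr_ge0.
apply: (@le_trans _ _ (\sum_(i : I) c i * W i t)).
  apply: ler_sum => i _; apply: ler_wpM2l (c_ge0 i) _ _ _.
  by have [_ /andP[]] := W_supp i t.
apply: recourse_cost_ge zu_feas => [i|i j]; rewrite /c ge_min ?lexx //.
by apply/orP; right; exact: (min_over_le J_gt0 (fun j => beta * d i j)).
Qed.
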